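(* For every cardinal $\tau>\omega_1$, the hyperspace $\mathrm{mpcc}(\mathbb R^\tau)$ is not an absolute retract (i.e. is not homeomorphic to a retract of a functionally open subspace of a power of $\mathbb R$; in particular it is not homeomorphic to $\mathbb R^\tau$).
   Context: For a cardinal $\tau$, $x,y\in\mathbb R^\tau$ and $\lambda\in\mathbb R_{\max}=\mathbb R\cup\{-\infty\}$, $x\oplus y$ denotes the coordinatewise maximum and $\lambda\odot x$ the vector obtained by adding $\lambda$ to every coordinate. A subset $A\subset\mathbb R^\tau$ is max-plus convex if $\alpha\odot a\oplus\beta\odot b\in A$ for all $a,b\in A$ and $\alpha,\beta\in\mathbb R_{\max}$ with $\max(\alpha,\beta)=0$. $\mathrm{mpcc}(\mathbb R^\tau)$ is the set of nonempty compact max-plus convex subsets of $\mathbb R^\tau$ (Tychonov product topology) with the Vietoris topology. Absolute retracts here are meant in the sense of the theory of nonmetrizable absolute extensors (Chigogidze): for Tychonov spaces of weight $\tau$, these are retracts of functionally open subspaces of powers of the real line; a set $U\subset X$ is functionally open if $U=f^{-1}((0,1])$ for a continuous $f\colon X\to[0,1]$. *)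

(* Defs.v *)
From Stdlib Require Import Reals List.
Open Scope R_scope.

Definition opens (X : Type) := (X -> Prop) -> Prop.

Definition generated {X : Type} (S : opens X) : opens X :=
  fun U => forall x, U x -> exists l : list (X -> Prop),
    Forall S l /\ Forall (fun V => V x) l /\
    (forall y, Forall (fun V => V y) l -> U y).

Definition R_open : opens R :=
  fun U => forall x, U x -> exists eps, 0 < eps /\
    forall y, Rabs (y - x) < eps -> U y.

Definition prod_top (I : Type) : opens (I -> R) :=
  generated (fun V => exists (i : I) (U : R -> Prop),
    R_open U /\ forall f, V f <-> U (f i)).

Definition subspace {X : Type} (O : opens X) (P : X -> Prop) : opens {x | P x} :=
  fun V => exists U, O U /\ forall z, V z <-> U (proj1_sig z).

Definition continuous {X Y : Type} (OX : opens X) (OY : opens Y) (f : X -> Y) :=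
  forall V, OY V -> OX (fun x => V (f x)).

Definition homeomorphic {X Y : Type} (OX : opens X) (OY : opens Y) :=
  exists (f : X -> Y) (g : Y -> X),
    (forall x, g (f x) = x) /\ (forall y, f (g y) = y) /\
    continuous OX OY f /\ continuous OY OX g.

Definition compact {X : Type} (O : opens X) (K : X -> Prop) :=
  forall C : (X -> Prop) -> Prop,
    (forall U, C U -> O U) ->
    (forall x, K x -> exists U, C U /\ U x) ->
    exists l : list (X -> Prop), Forall C l /\
      forall x, K x -> exists U, In U l /\ U x.

(* Max-plus structure: R_max = R ∪ {-oo}, with None = -oo. *)
Definition Rmaxplus := option R.

Definition mp_max (a b : Rmaxplus) : Rmaxplus :=
  match a, b with
  | None, None => None
  | Some x, None => Some x
  | None, Some y => Some y
  | Some x, Some y => Some (Rmax x y)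
  end.

(* alpha ⊙ a ⊕ beta ⊙ b (coordinatewise); the case alpha = beta = -oo
   never occurs under max(alpha,beta) = 0 and is given a dummy value. *)
Definition mp_comb {T : Type} (alpha : Rmaxplus) (a : T -> R)
    (beta : Rmaxplus) (b : T -> R) : T -> R :=
  fun t => match alpha, beta with
  | Some x, Some y => Rmax (x + a t) (y + b t)
  | Some x, None => x + a t
  | None, Some y => y + b t
  | None, None => 0
  end.

Definition mp_convex {T : Type} (A : (T -> R) -> Prop) :=
  forall a b alpha beta, A a -> A b -> mp_max alpha beta = Some 0 ->
    A (mp_comb alpha a beta b).

Definition mpcc_pred (T : Type) (K : (T -> R) -> Prop) :=
  (exists x, K x) /\ compact (prod_top T) K /\ mp_convex K.

Definition mpcc (T : Type) := {K : (T -> R) -> Prop | mpcc_pred T K}.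

Definition vietoris (T : Type) : opens (mpcc T) :=
  generated (fun V => exists U, prod_top T U /\
    ((forall K, V K <-> forall x, proj1_sig K x -> U x) \/
     (forall K, V K <-> exists x, proj1_sig K x /\ U x))).

Definition functionally_open {X : Type} (O : opens X) (W : X -> Prop) :=
  exists f : X -> R, continuous O R_open f /\ (forall x, 0 <= f x <= 1) /\
    forall x, W x <-> 0 < f x.

Definition retract_of {X : Type} (O : opens X) (Y W : X -> Prop) :=
  (forall x, Y x -> W x) /\
  exists r : {x | W x} -> {x | Y x},
    continuous (subspace O W) (subspace O Y) r /\
    forall z : {x | W x}, Y (proj1_sig z) -> proj1_sig (r z) = proj1_sig z.

Definition absolute_retract {Z : Type} (OZ : opens Z) :=
  exists (kappa : Type) (W Y : (kappa -> R) -> Prop),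
    functionally_open (prod_top kappa) W /\
    retract_of (prod_top kappa) Y W /\
    homeomorphic OZ (subspace (prod_top kappa) Y).

Definition countable (T : Type) :=
  exists f : T -> nat, forall x y, f x = f y -> x = y.

(* |T| <= omega_1 iff T carries a strict well-order all of whose proper
   initial segments are countable. *)
Definition card_le_omega1 (T : Type) :=
  exists lt : T -> T -> Prop,
    (forall x, ~ lt x x) /\
    (forall x y z, lt x y -> lt y z -> lt x z) /\
    (forall x y, lt x y \/ x = y \/ lt y x) /\
    well_founded lt /\
    (forall x, countable {y | lt y x}).

(* Main.v *)
(* Suppose h is a homeomorphism of mpcc(R^tau) onto a retract of an open subset
   W of R^K, and let g : W -> mpcc(R^tau) be the retraction followed by the
   inverse of h. Let theta send a pair of points of [0,1]^tau to the image under h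
   of the max-plus segment joining them. Fix c in tau. For t in tau the trace of g w
   on the coordinates t and c depends only on a countable set A t of coordinates of
   w, and the coordinates of theta in A t depend only on a countable set B t of
   coordinates of the two endpoints. As tau has more than omega_1 elements, there
   are a, b with a not in B b and b not in B a. In the coordinates (a, b, c), all
   others being zero, let

     S_0 = [(0,0,0), (1,1,0)] = {(s,s,0)},    S_e = [(0,1,0), (1,0,e)].

   Forgetting b, S_e is close to S_0; forgetting a, it is so again, after the two
   endpoints are exchanged. Hence the point w equal to h(S_e) on A a and A b and to
   h(S_0) elsewhere is close to h(S_0), so that g w is close to S_0 and
   |x_a - x_b| < 1/3 on g w. But g w has the same (a,c)- and (b,c)-projections as
   S_e: it contains a point with x_a = x_c = 0, and x_c < e forces x_b = 1. *)

Require Import Defs.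
From Stdlib Require Import Reals List Lra Lia Classical ClassicalChoice ClassicalEpsilon.
From Stdlib Require Import FunctionalExtensionality PropExtensionality ProofIrrelevance.
From Stdlib Require Cantor.
From mathcomp Require boolp wochoice.
Import ListNotations.

(** * Countable sets and free pairs *)

(** The library principle gives every nonempty set a unique minimum. Minima of pairs yield totality
    and antisymmetry, minima of triples yield transitivity, and a minimal non-accessible point
    refutes itself. *)
Lemma well_ordering (T : Type) : exists lt : T -> T -> Prop,
  (forall x, ~ lt x x) /\
  (forall x y z, lt x y -> lt y z -> lt x z) /\
  (forall x y, lt x y \/ x = y \/ lt y x) /\
  well_founded lt.
Proof.
  destruct (wochoice.well_ordering_principle
    (boolp.boolp_classicType__canonical__eqtype_Equality T)) as [le Hle].
  simpl in le, Hle.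
  assert (Hmin : forall P : T -> Prop, (exists x, P x) ->
      exists z, (P z /\ forall y, P y -> le z y = true) /\
      forall z', (P z' /\ forall y, P y -> le z' y = true) -> z = z').
  { intros P [x Px].
    destruct (Hle (fun x => boolp.asbool (P x))) as [z [[Hz Hl] Hu]].
    { exists x. unfold ssrbool.in_mem; simpl. apply boolp.asboolT, Px. }
    unfold ssrbool.in_mem in *; simpl in *.
    exists z. split; [split|].
    - apply boolp.asboolW, Hz.
    - intros y Py. apply Hl. apply boolp.asboolT, Py.
    - intros z' [Pz' Hl']. apply Hu. split; [apply boolp.asboolT, Pz'|].
      intros y Hy. apply Hl'. apply boolp.asboolW, Hy. }
  assert (Htot : forall x y, le x y = true \/ le y x = true).
  { intros x y. destruct (Hmin (fun z => z = x \/ z = y)) as [z [[[->| ->] Hl] _]];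
      [exists x; auto| left | right]; apply Hl; auto. }
  assert (Hanti : forall x y, le x y = true -> le y x = true -> x = y).
  { intros x y Hxy Hyx.
    assert (Hrefl : forall u, le u u = true) by (intros u; destruct (Htot u u); auto).
    destruct (Hmin (fun z => z = x \/ z = y)) as [z [_ Hu]]; [exists x; auto|].
    transitivity z; [symmetry|]; apply Hu; split; auto; intros u [->| ->]; auto. }
  exists (fun x y => le x y = true /\ x <> y).
  split; [|split; [|split]].
  - intros x [_ H]; auto.
  - intros x y z [Hxy Nxy] [Hyz Nyz].
    destruct (Hmin (fun u => u = x \/ u = y \/ u = z)) as [u [[Hu Hl] _]]; [exists x; auto|].
    destruct Hu as [->|[->| ->]].
    + split; [apply Hl; auto|]. intros ->. apply Nxy, Hanti; auto.
    + exfalso. apply Nxy, Hanti; [auto|apply Hl; auto].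
    + exfalso. apply Nyz, Hanti; [auto|apply Hl; auto].
  - intros x y. destruct (classic (x = y)) as [E|N]; [auto|].
    destruct (Htot x y); [left|right; right]; split; auto.
  - intros x. apply NNPP. intros Hx.
    destruct (Hmin (fun x => ~ Acc (fun x y => le x y = true /\ x <> y) x)) as [z [[Hz Hl] _]];
      [exists x; exact Hx|].
    apply Hz. constructor. intros y [Hyz Nyz]. apply NNPP. intros Hy.
    apply Nyz, Hanti; auto.
Qed.

(** The finite lists may contain points outside [A], so empty sets need no special case and subsets
    inherit the same enumeration. *)
Definition enumerable {X : Type} (A : X -> Prop) :=
  exists e : nat -> list X, forall s, A s -> exists n, In s (e n).

Lemma enumerable_sub {X : Type} (A B : X -> Prop) :
  (forall s, A s -> B s) -> enumerable B -> enumerable A.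
Proof. intros HAB [e He]. exists e. auto. Qed.

Lemma enumerable_union {I X : Type} (A : I -> Prop) (F : I -> X -> Prop) :
  enumerable A -> (forall i, A i -> enumerable (F i)) ->
  enumerable (fun s => exists i, A i /\ F i s).
Proof.
  intros [e He] HF.
  destruct (choice (fun i (f : nat -> list X) => A i -> forall s, F i s -> exists n, In s (f n)))
    as [f Hf].
  { intros i. destruct (classic (A i)) as [Ai|N].
    - destruct (HF i Ai) as [f Hf]. exists f. auto.
    - exists (fun _ => []). tauto. }
  (* Stage [n] uses the first [n] lists of indices and, for each index, its first [n] lists of
     members. As [seq 0 n] omits [n], stage [S (n + m)] reaches both positions. *)
  exists (fun n => flat_map (fun i => flat_map (f i) (seq 0 n)) (flat_map e (seq 0 n))).
  intros s [i [Ai Fis]]. destruct (He i Ai) as [n Hn]. destruct (Hf i Ai s Fis) as [m Hm].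
  exists (S (n + m))%nat. apply in_flat_map. exists i. split; apply in_flat_map.
  - exists n. rewrite in_seq. split; [lia|auto].
  - exists m. rewrite in_seq. split; [lia|auto].
Qed.

Lemma enumerable_nat (A : nat -> Prop) : enumerable A.
Proof. exists (fun n => [n]). intros n _. exists n. simpl; auto. Qed.

Lemma enumerable_or {X : Type} (A B : X -> Prop) :
  enumerable A -> enumerable B -> enumerable (fun s => A s \/ B s).
Proof.
  intros [e He] [f Hf]. exists (fun n => e n ++ f n).
  intros s [Hs|Hs]; [destruct (He s Hs) as [n Hn]|destruct (Hf s Hs) as [n Hn]];
    exists n; apply in_or_app; auto.
Qed.

Lemma enumerable_eq {X : Type} (a : X) : enumerable (fun s => s = a).
Proof. exists (fun _ => [a]). intros s ->. exists 0%nat. simpl; auto. Qed.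

Lemma enumerable_countable {X : Type} (A : X -> Prop) :
  enumerable A -> countable {s | A s}.
Proof.
  intros [e He].
  destruct (choice (fun (z : {s | A s}) (p : nat * nat) =>
      nth_error (e (fst p)) (snd p) = Some (proj1_sig z))) as [f Hf].
  { intros [s As]. destruct (He s As) as [n Hn].
    destruct (In_nth_error _ _ Hn) as [i Hi]. exists (n, i). exact Hi. }
  exists (fun z => Cantor.to_nat (f z)). intros x y E.
  apply Cantor.to_nat_inj in E.
  assert (E' : Some (proj1_sig x) = Some (proj1_sig y)) by (rewrite <- !Hf, E; auto).
  injection E'. destruct x as [x Hx], y as [y Hy]; simpl. intros ->.
  f_equal. apply proof_irrelevance.
Qed.

Fixpoint words {X : Type} (l : list X) (n : nat) : list (list X) :=
  match n with
  | 0%nat => [[]]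
  | S n => words l n ++ flat_map (fun w => map (fun x => x :: w) l) (words l n)
  end.

Lemma in_words {X : Type} (l : list X) (n : nat) (w : list X) :
  (length w <= n)%nat -> incl w l -> In w (words l n).
Proof.
  revert w; induction n as [|n IH]; intros w Hn Hw.
  - destruct w; simpl in *; [auto|lia].
  - simpl. apply in_or_app. destruct w as [|x w].
    + left. apply IH; simpl; [lia|auto].
    + right. apply in_flat_map. exists w. apply incl_cons_inv in Hw. split.
      * apply IH; [simpl in Hn; lia|tauto].
      * apply (in_map (fun x => x :: w)). tauto.
Qed.

(** The set is a union of finite stages; the next stage adds [op] of all short words over the
    present one with small tags, and any finite list lies in some stage. The natural-number tags let
    a countable set of values be produced by an [op] with finite output. *)
Lemma enumerable_closure {X : Type} (op : list (X * nat) -> list X) :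
  exists A : X -> Prop, enumerable A /\
    forall l, (forall p, In p l -> A (fst p)) -> forall s, In s (op l) -> A s.
Proof.
  pose (E := fix E n := match n with
    | 0%nat => []
    | S n => E n ++ flat_map op (words (list_prod (E n) (seq 0 n)) n)
    end).
  assert (Emono : forall n m, (n <= m)%nat -> incl (E n) (E m)).
  { intros n m H; induction H; [apply incl_refl|].
    simpl. apply incl_appl; auto. }
  exists (fun s => exists n, In s (E n)). split; [exists E; auto|].
  intros l Hl s Hs.
  assert (exists n, incl l (list_prod (E n) (seq 0 n))) as [n Hn].
  { clear Hs. induction l as [|[t k] l IH]; [exists 0%nat; intros ? []|].
    destruct IH as [n Hn]; [intros p Hp; apply Hl; right; auto|].
    destruct (Hl (t, k)) as [m Hm]; [left; auto|]. simpl in Hm.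
    exists (n + m + S k)%nat.
    intros [t' k'] [H|H].
    - injection H as <- <-. apply in_prod; [|apply in_seq; lia].
      revert Hm; apply Emono; lia.
    - apply Hn in H. apply in_prod_iff in H. rewrite in_seq in H.
      apply in_prod; [|apply in_seq; lia]. destruct H as [H _]. revert H; apply Emono; lia. }
  exists (S (n + length l))%nat. simpl. apply in_or_app; right.
  apply in_flat_map. exists l. split; [|auto].
  apply in_words; [lia|]. intros [t k] H. apply Hn, in_prod_iff in H. rewrite in_seq in H.
  apply in_prod; [|apply in_seq; lia]. destruct H as [H _]. revert H; apply Emono; lia.
Qed.

(* If c is least with uncountably many predecessors and all pairs are comparable
   for f, then an x outside the closures under f of the i < c would have all of
   them inside f x. So these countable closures cover T, and T is ordered by the
   first closure in which a point occurs. *)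
Lemma free_pair {T : Type} (f : T -> T -> Prop) :
  ~ card_le_omega1 T -> (forall a, enumerable (f a)) ->
  exists a b, ~ f a b /\ ~ f b a.
Proof.
  intros HT Hf. apply NNPP. intros Hfree. apply HT. clear HT.
  destruct (well_ordering T) as [lt [Hirr [Htr [Htot Hwf]]]].
  destruct (classic (forall x, enumerable (fun y => lt y x))) as [Hc|Hc].
  { exists lt. do 4 (split; auto). intros x. apply enumerable_countable, Hc. }
  assert (Hleast : forall P : T -> Prop, (exists x, P x) ->
      exists z, P z /\ forall y, P y -> ~ lt y z).
  { intros P [x Px]. apply NNPP. intros N. revert Px. induction x as [x IH] using (well_founded_ind Hwf).
    intros Px. apply N. exists x. split; [auto|]. intros y Py Hy. exact (IH y Hy Py). }
  apply not_all_ex_not in Hc. destruct (Hleast _ Hc) as [c [Hcu Hcl]].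
  destruct (choice (fun a (e : nat -> list T) => forall s, f a s -> exists n, In s (e n)) Hf)
    as [e He].
  assert (Hcl' : forall i, exists A : T -> Prop, enumerable A /\ A i /\
      forall a s, A a -> f a s -> A s).
  { intros i.
    (* The tag of a singleton selects one list of the enumeration of [f a]; the empty list produces
       the seed [i]. *)
    destruct (enumerable_closure (fun l => match l with
       | [(a, n)] => e a n | _ => [i] end)) as [A [EA HA]].
    exists A. split; [auto|split].
    - apply (HA []); [intros ? []|left; auto].
    - intros a s Aa Hs. destruct (He a s Hs) as [n Hn].
      apply (HA [(a, n)]); [|auto]. intros p [<-|[]]. auto. }
  apply choice in Hcl'. destruct Hcl' as [cl Hcl'].
  assert (Hcov : forall x, exists i, cl i x /\ forall j, cl j x -> ~ lt j i).
  { intros x. apply Hleast. exists x. apply Hcl'. }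
  assert (Hcov' : forall x, exists i, lt i c /\ cl i x).
  { intros x. apply NNPP. intros N. apply Hcu.
    apply (enumerable_sub _ (f x)); [|auto].
    intros d Hd. apply NNPP. intros Nd. apply Hfree. exists x, d. split; [auto|].
    intros Hdx. apply N. exists d. split; [auto|].
    destruct (Hcl' d) as [_ [Hd0 Hd1]]. eauto. }
  apply choice in Hcov. destruct Hcov as [rho Hrho].
  assert (Hrc : forall x, lt (rho x) c).
  { intros x. destruct (Hcov' x) as [i [Hi Hx]].
    destruct (Htot (rho x) i) as [H|[->|H]]; eauto.
    exfalso. apply (proj2 (Hrho x) i); auto. }
  (* Points with the same first closure are compared by the original order. *)
  exists (fun x y => lt (rho x) (rho y) \/ (rho x = rho y /\ lt x y)).
  split; [|split; [|split; [|split]]].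
  - intros x [H|[_ H]]; eapply Hirr; eauto.
  - intros x y z [H|[E H]] [H'|[E' H']].
    + left; eauto.
    + left; rewrite <- E'; auto.
    + left; rewrite E; auto.
    + right; split; [congruence|eauto].
  - intros x y. destruct (Htot (rho x) (rho y)) as [H|[E|H]]; auto.
    destruct (Htot x y) as [H|[H|H]]; auto.
  - intros x. remember (rho x) as i eqn:Ei. revert x Ei.
    induction i as [i IHi] using (well_founded_ind Hwf).
    intros x. induction x as [x IHx] using (well_founded_ind Hwf).
    intros Ei. constructor. intros y [H|[E H]].
    + apply (IHi (rho y)); [congruence|auto].
    + apply IHx; [auto|congruence].
  - intros x. apply enumerable_countable.
    (* The predecessors of [x] lie in the closures with index at most [rho x]. These indices are
       countably many, because [rho x] precedes [c]. *)
    apply (enumerable_sub _ (fun y => exists i, (lt i (rho x) \/ i = rho x) /\ cl i y)).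
    { intros y [H|[E H]]; exists (rho y); (split; [auto|apply Hrho]). }
    apply enumerable_union.
    + apply enumerable_or; [|apply enumerable_eq].
      apply NNPP. intros N. exact (Hcl (rho x) N (Hrc x)).
    + intros i _. apply Hcl'.
Qed.

(** * The product topology and dependence on countably many coordinates *)

Lemma generated_local {X : Type} (S : opens X) (U : X -> Prop) :
  (forall x, U x -> exists O, generated S O /\ O x /\ forall y, O y -> U y) ->
  generated S U.
Proof.
  intros H x Ux. destruct (H x Ux) as [O [HO [Ox HOU]]].
  destruct (HO x Ox) as [l [Hl [Hx Hy]]]. exists l. auto.
Qed.

Lemma generated_subbasic {X : Type} (S : opens X) (V : X -> Prop) :
  S V -> generated S V.
Proof.
  intros HV x Vx. exists [V]. repeat split; auto.
  intros y Hy. inversion Hy; auto.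
Qed.

Lemma generated_and {X : Type} (S : opens X) (U V : X -> Prop) :
  generated S U -> generated S V -> generated S (fun x => U x /\ V x).
Proof.
  intros HU HV x [Ux Vx].
  destruct (HU x Ux) as [l [Hl [Hlx Hly]]]. destruct (HV x Vx) as [m [Hm [Hmx Hmy]]].
  exists (l ++ m). rewrite !Forall_app. repeat split; auto;
    apply Forall_app in H; [apply Hly|apply Hmy]; tauto.
Qed.

Lemma continuous_generated {X Y : Type} (S : opens X) (S' : opens Y) (f : X -> Y) :
  (forall V, S' V -> generated S (fun x => V (f x))) ->
  continuous (generated S) (generated S') f.
Proof.
  intros H V HV. apply generated_local. intros x Vx.
  destruct (HV _ Vx) as [l [Hl [Hlx Hly]]].
  exists (fun y => Forall (fun V => V (f y)) l). split; [|split; auto].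
  clear Hlx Hly. induction l as [|W l IH].
  - intros y _. exists []. repeat split; auto.
  - inversion Hl; subst.
    intros y Hy. inversion Hy; subst.
    destruct (generated_and S (fun y => W (f y)) (fun y => Forall (fun V => V (f y)) l)
      (H W H2) (IH H3) y) as [k [Hk [Hky Hkz]]]; [auto|].
    exists k. repeat split; auto. intros z Hz. destruct (Hkz z Hz). auto.
Qed.

Lemma prod_top_nbhd {I : Type} (U : (I -> R) -> Prop) (x : I -> R) :
  prod_top I U -> U x -> exists (F : list I) (eps : R), 0 < eps /\
    forall y, (forall i, In i F -> Rabs (y i - x i) < eps) -> U y.
Proof.
  intros HU Ux. destruct (HU x Ux) as [l [Hl [Hlx Hly]]].
  assert (exists (F : list I) (eps : R), 0 < eps /\ forall y,
    (forall i, In i F -> Rabs (y i - x i) < eps) -> Forall (fun V => V y) l)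
    as [F [eps [Heps HF]]]; [|exists F, eps; auto].
  clear Hly. induction l as [|V l IH].
  - exists [], 1. split; [lra|auto].
  - inversion Hl as [|? ? [i [O [HO HVO]]] Hl']; subst. inversion Hlx as [|? ? HVx Hlx']; subst.
    destruct (IH Hl' Hlx') as [F [eps [Heps HF]]].
    destruct (HO (x i)) as [del [Hdel HO']]; [apply HVO; auto|].
    exists (i :: F), (Rmin eps del). split; [apply Rmin_pos; auto|].
    intros y Hy. constructor.
    + apply HVO, HO'. eapply Rlt_le_trans; [apply Hy; left; auto|apply Rmin_r].
    + apply HF. intros j Hj. eapply Rlt_le_trans; [apply Hy; right; auto|apply Rmin_l].
Qed.

Lemma prod_top_coord {I : Type} (i : I) (O : R -> Prop) :
  R_open O -> prod_top I (fun x => O (x i)).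
Proof. intros HO. apply generated_subbasic. exists i, O. split; [auto|tauto]. Qed.

Lemma R_open_lt (a : R) : R_open (fun r => r < a).
Proof.
  intros r Hr. exists (a - r). split; [lra|]. intros y Hy.
  apply Rabs_def2 in Hy. lra.
Qed.

Lemma R_open_gt (a : R) : R_open (fun r => a < r).
Proof.
  intros r Hr. exists (r - a). split; [lra|]. intros y Hy.
  apply Rabs_def2 in Hy. lra.
Qed.

Lemma R_open_ball (a eps : R) : R_open (fun r => Rabs (r - a) < eps).
Proof.
  intros r Hr. exists (eps - Rabs (r - a)). split; [lra|].
  intros s Hs. replace (s - a) with ((s - r) + (r - a)) by lra.
  pose proof (Rabs_triang (s - r) (r - a)). lra.
Qed.

Lemma generated_forall_in {X J : Type} (S : opens X) (l : list J) (P : J -> X -> Prop) :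
  (forall j, generated S (P j)) -> generated S (fun x => forall j, In j l -> P j x).
Proof.
  intros HP. induction l as [|j l IH].
  - intros x _. exists []. repeat split; auto. intros y _ j [].
  - apply generated_local. intros x Hx.
    exists (fun x => P j x /\ forall j', In j' l -> P j' x). split; [|split].
    + apply generated_and; auto.
    + split; [apply Hx; left; auto|]. intros j' Hj'. apply Hx; right; auto.
    + intros y [Hy Hy'] j' [<-|Hj']; auto.
Qed.

Lemma prod_top_ball {I : Type} (F : list I) (x : I -> R) (eps : R) :
  prod_top I (fun y => forall i, In i F -> Rabs (y i - x i) < eps).
Proof.
  apply generated_forall_in. intros i.
  apply (prod_top_coord i (fun r => Rabs (r - x i) < eps)), R_open_ball.
Qed.

Lemma prod_top_intro {I : Type} (U : (I -> R) -> Prop) :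
  (forall x, U x -> exists (F : list I) (eps : R), 0 < eps /\
    forall y, (forall i, In i F -> Rabs (y i - x i) < eps) -> U y) ->
  prod_top I U.
Proof.
  intros H. apply generated_local. intros x Ux. destruct (H x Ux) as [F [eps [Heps HF]]].
  exists (fun y => forall i, In i F -> Rabs (y i - x i) < eps).
  split; [apply prod_top_ball|split; [|auto]].
  intros i _. rewrite Rminus_diag, Rabs_R0. auto.
Qed.

(** A difference of two naturals over a positive denominator: every rational occurs, with
    repetitions. *)
Definition rational (n : nat) : R :=
  let (m, k) := Cantor.of_nat n in
  let (i, j) := Cantor.of_nat m in (INR i - INR j) / INR (S k).

Lemma rational_dense (a b : R) : a < b -> exists n, a < rational n < b.
Proof.
  intros Hab.
  (* With a denominator exceeding [1 / (b - a)], the least numerator that puts the fraction above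
     [a] still leaves it below [b]. *)
  destruct (archimed_cor1 (b - a)) as [k [Hk Hk0]]; [lra|].
  destruct k as [|k]; [lia|]. clear Hk0.
  assert (HK : 0 < INR (S k)) by (apply lt_0_INR; lia).
  destruct (archimed (a * INR (S k))) as [Hu1 Hu2].
  set (z := up (a * INR (S k))) in *.
  assert (Hz : exists i j, IZR z = INR i - INR j).
  { exists (Z.to_nat z), (Z.to_nat (- z)).
    rewrite !INR_IZR_INZ, <- minus_IZR. f_equal. lia. }
  destruct Hz as [i [j Hz]].
  exists (Cantor.to_nat (Cantor.to_nat (i, j), k)).
  unfold rational. rewrite !Cantor.cancel_of_to, <- Hz.
  split.
  - apply Rmult_lt_reg_r with (INR (S k)); [auto|]. unfold Rdiv.
    rewrite Rmult_assoc, Rinv_l by lra. lra.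
  - apply Rmult_lt_reg_r with (INR (S k)); [auto|]. unfold Rdiv.
    rewrite Rmult_assoc, Rinv_l by lra.
    assert (1 < (b - a) * INR (S k)).
    { apply Rmult_lt_reg_l with (/ INR (S k)); [apply Rinv_0_lt_compat; auto|].
      rewrite (Rmult_comm (b - a)), <- Rmult_assoc, Rinv_l by lra. lra. }
    lra.
Qed.

Definition interval (n : nat) (r : R) :=
  let (i, j) := Cantor.of_nat n in rational i < r < rational j.

Lemma interval_nbhd (r eps : R) : 0 < eps ->
  exists n, interval n r /\ forall s, interval n s -> Rabs (s - r) < eps.
Proof.
  intros Heps.
  destruct (rational_dense (r - eps) r) as [i Hi]; [lra|].
  destruct (rational_dense r (r + eps)) as [j Hj]; [lra|].
  exists (Cantor.to_nat (i, j)). unfold interval. rewrite Cantor.cancel_of_to.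
  split; [lra|]. intros s Hs. apply Rabs_def1; lra.
Qed.

(** Basic open sets are coded by finite lists of coordinates tagged with naturals, the form on which
    [enumerable_closure] operates. *)
Definition box {I : Type} (l : list (I * nat)) (x : I -> R) :=
  forall p, In p l -> interval (snd p) (x (fst p)).

Lemma box_nbhd {I : Type} (U : (I -> R) -> Prop) (x : I -> R) :
  prod_top I U -> U x -> exists l, box l x /\ forall y, box l y -> U y.
Proof.
  intros HU Ux. destruct (prod_top_nbhd U x HU Ux) as [F [eps [Heps HF]]].
  destruct (choice (fun i n => interval n (x i) /\
    forall s, interval n s -> Rabs (s - x i) < eps)) as [f Hf].
  { intros i. apply interval_nbhd, Heps. }
  exists (map (fun i => (i, f i)) F). split.
  - intros p Hp. apply in_map_iff in Hp. destruct Hp as [i [<- Hi]]. apply Hf.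
  - intros y Hy. apply HF. intros i Hi. apply Hf.
    apply (Hy (i, f i)), in_map_iff. exists i; auto.
Qed.

(* Closing off A under "if U contains a basic box meeting the box l, add the
   coordinates of one such box" replaces the countable chain condition. *)
Lemma disjoint_opens_separated {I : Type} (U V : (I -> R) -> Prop) :
  prod_top I U -> prod_top I V -> (forall x, U x -> V x -> False) ->
  exists A : I -> Prop, enumerable A /\
    forall x y, U x -> V y -> (forall i, A i -> x i = y i) -> False.
Proof.
  intros HU HV Hdisj.
  destruct (choice (fun l m => (exists m', (forall z, box m' z -> U z) /\
      exists z, box m' z /\ box l z) ->
      (forall z, box m z -> U z) /\ exists z, box m z /\ box l z)) as [pick Hpick].
  { intros l. destruct (classic (exists m', (forall z, box m' z -> U z) /\
      exists z, box m' z /\ box l z)) as [[m Hm]|N]; [exists m; auto|exists []; tauto]. }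
  destruct (enumerable_closure (fun l => map fst (pick l))) as [A [EA HA]].
  exists A. split; [auto|]. intros x y Ux Vy Hxy.
  destruct (box_nbhd V y HV Vy) as [d [Hdy HdV]].
  (* [d'] keeps the conditions of [d] on coordinates in [A]. There [x] agrees with [y], so [x] lies
     in the box [d'], and some box inside [U] meets it. *)
  assert (exists d', (forall p, In p d' <-> In p d /\ A (fst p))) as [d' Hd'].
  { clear - d. induction d as [|p d [d' IH]]; [exists []; simpl; tauto|].
    destruct (classic (A (fst p))) as [Ap|N]; [exists (p :: d')|exists d'];
      simpl; intros q; rewrite IH; intuition (subst; auto; tauto). }
  destruct (Hpick d') as [HmU [z [Hmz Hdz]]].
  { destruct (box_nbhd U x HU Ux) as [m [Hmx HmU]]. exists m. split; [auto|].
    exists x. split; [auto|]. intros p Hp. apply Hd' in Hp. rewrite Hxy by tauto.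
    apply Hdy. tauto. }
  assert (HmA : forall p, In p (pick d') -> A (fst p)).
  { intros p Hp. apply (HA d'); [intros q Hq; apply Hd', Hq|].
    apply in_map, Hp. }
  (* Gluing [z] on [A] to [y] off [A] gives a point of both [U] and [V]: the chosen box restricts
     only coordinates in [A], and [d] is satisfied by [z] on [A] and by [y] elsewhere. *)
  destruct (choice (fun i r => (A i -> r = z i) /\ (~ A i -> r = y i))) as [z' Hz'].
  { intros i. destruct (classic (A i)); [exists (z i)|exists (y i)]; tauto. }
  apply (Hdisj z').
  - apply HmU. intros p Hp. destruct (Hz' (fst p)) as [-> _]; auto.
  - apply HdV. intros p Hp. destruct (classic (A (fst p))) as [Ap|N].
    + destruct (Hz' (fst p)) as [-> _]; auto. apply Hdz, Hd'. auto.
    + destruct (Hz' (fst p)) as [_ ->]; auto.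
Qed.

Lemma disjoint_open_families_separated {I : Type} (U V : nat -> (I -> R) -> Prop) :
  (forall n, prod_top I (U n)) -> (forall n, prod_top I (V n)) ->
  (forall n x, U n x -> V n x -> False) ->
  exists A : I -> Prop, enumerable A /\
    forall n x y, U n x -> V n y -> (forall i, A i -> x i = y i) -> False.
Proof.
  intros HU HV Hdisj.
  destruct (choice (fun n A => enumerable A /\ forall x y,
    U n x -> V n y -> (forall i, A i -> x i = y i) -> False)) as [A HA].
  { intros n. apply disjoint_opens_separated; eauto. }
  exists (fun i => exists n : nat, True /\ A n i). split.
  - apply enumerable_union; [apply enumerable_nat|]. intros n _. apply HA.
  - intros n x y Ux Vy Hxy. apply (proj2 (HA n) x y); auto.
    intros i Hi. apply Hxy. eauto.
Qed.

(** Two different values are separated by a rational, and the preimages of the two open rays at that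
    rational are disjoint open sets. *)
Lemma continuous_coord_countable {I K : Type} (f : (I -> R) -> K -> R) (k : K) :
  continuous (prod_top I) (prod_top K) f ->
  exists A : I -> Prop, enumerable A /\
    forall x y, (forall i, A i -> x i = y i) -> f x k = f y k.
Proof.
  intros Hf.
  destruct (disjoint_open_families_separated
    (fun n x => f x k < rational n) (fun n x => rational n < f x k)) as [A [EA HA]].
  - intros n. apply (Hf (fun w => w k < rational n)).
    apply (prod_top_coord k (fun r => r < rational n)), R_open_lt.
  - intros n. apply (Hf (fun w => rational n < w k)).
    apply (prod_top_coord k (fun r => rational n < r)), R_open_gt.
  - intros; lra.
  - exists A. split; [auto|]. intros x y Hxy.
    destruct (Rtotal_order (f x k) (f y k)) as [H|[H|H]]; [|auto|];
      exfalso; destruct (rational_dense _ _ H) as [n Hn].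
    + apply (HA n x y); [lra|lra|auto].
    + apply (HA n y x); [lra|lra|]. intros i Hi. symmetry; auto.
Qed.

(** * Max-plus segments *)

(** Compactness of [[a, b]] for properties of subintervals that can be chained, by a supremum
    argument. It serves both the compactness of segments and the uniformity in the parameter when
    endpoints move. *)
Lemma interval_chain (Q : R -> R -> Prop) (a b : R) :
  a <= b ->
  (forall u v w, Q u v -> Q v w -> Q u w) ->
  (forall s, a <= s <= b -> exists d, 0 < d /\
    forall u v, s - d < u -> u <= s <= v -> v < s + d -> Q u v) ->
  Q a b.
Proof.
  intros Hab Htr Hloc.
  destruct (completeness (fun t => a <= t <= b /\ Q a t)) as [m [Hub Hlub]].
  - exists b. intros t Ht. lra.
  - exists a. split; [lra|]. destruct (Hloc a) as [d [Hd HQ]]; [lra|]. apply HQ; lra.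
  - assert (Ham : a <= m).
    { apply Hub. split; [lra|]. destruct (Hloc a) as [d [Hd HQ]]; [lra|]. apply HQ; lra. }
    assert (Hmb : m <= b) by (apply Hlub; intros t Ht; lra).
    destruct (Hloc m) as [d [Hd HQ]]; [lra|].
    assert (exists t, m - d < t /\ a <= t <= b /\ Q a t) as [t [Ht [Htab HQt]]].
    { apply NNPP. intros N. assert (m <= m - d); [|lra].
      apply Hlub. intros t Ht. apply Rnot_lt_le. intros H. apply N. exists t; auto. }
    assert (Htm : t <= m) by (apply Hub; auto).
    destruct (Rle_lt_or_eq_dec m b Hmb) as [Hlt| ->].
    + exfalso. set (m' := Rmin b (m + d / 2)).
      assert (Hm' : m < m' <= b /\ m' < m + d).
      { unfold m', Rmin. destruct (Rle_dec b (m + d / 2)); lra. }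
      assert (m' <= m); [|lra]. apply Hub. split; [lra|].
      apply Htr with t; [auto|]. apply HQ; lra.
    + apply Htr with t; [auto|]. apply HQ; lra.
Qed.

(** Coefficients [p], [q] with maximum 0 are determined by [s = q - p]: one is 0 and the other is
    minus the absolute value of [s]. *)
Definition mp_path {T : Type} (a b : T -> R) (s : R) : T -> R :=
  fun t => Rmax (Rmin 0 (- s) + a t) (Rmin 0 s + b t).

(** Real coefficients suffice for endpoints in the unit cube, where each endpoint is already reached
    by giving the other one the coefficient -1. *)
Definition mp_segment {T : Type} (a b : T -> R) : (T -> R) -> Prop :=
  fun x => exists p q, Rmax p q = 0 /\ x = fun t => Rmax (p + a t) (q + b t).

Ltac minmax := unfold Rmax, Rmin, Rabs in *;
  repeat (match goal with
  | |- context [Rle_dec ?u ?v] => destruct (Rle_dec u v)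
  | |- context [Rcase_abs ?u] => destruct (Rcase_abs u)
  | H : context [Rle_dec ?u ?v] |- _ => destruct (Rle_dec u v)
  | H : context [Rcase_abs ?u] |- _ => destruct (Rcase_abs u)
  end); lra.

Lemma mp_path_lipschitz {T : Type} (a b a' b' : T -> R) (s s' eps : R) (t : T) :
  Rabs (a t - a' t) < eps -> Rabs (b t - b' t) < eps -> Rabs (s - s') < eps ->
  Rabs (mp_path a b s t - mp_path a' b' s' t) < 2 * eps.
Proof.
  intros Ha Hb Hs. apply Rabs_def2 in Ha, Hb, Hs.
  apply Rabs_def1; unfold mp_path; minmax.
Qed.

(* A coefficient below -1 is as good as -oo, because the coordinates lie in [0, 1]. *)
Lemma mp_segment_path {T : Type} (a b x : T -> R) :
  (forall t, 0 <= a t <= 1) -> (forall t, 0 <= b t <= 1) ->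
  mp_segment a b x <-> exists s, -1 <= s <= 1 /\ x = mp_path a b s.
Proof.
  intros Ha Hb. split.
  - intros [p [q [Hpq ->]]]. exists (Rmax (-1) (Rmin 1 (q - p))). split; [minmax|].
    apply functional_extensionality. intros t. specialize (Ha t). specialize (Hb t).
    unfold mp_path. minmax.
  - intros [s [Hs ->]]. exists (Rmin 0 (- s)), (Rmin 0 s). split; [minmax|reflexivity].
Qed.

Lemma mp_segment_comm {T : Type} (a b : T -> R) : mp_segment a b = mp_segment b a.
Proof.
  apply functional_extensionality. intros x. apply propositional_extensionality.
  split; intros [p [q [Hpq ->]]]; exists q, p; rewrite Rmax_comm; (split; [auto|]);
    apply functional_extensionality; intros t; apply Rmax_comm.
Qed.

Lemma mp_segment_convex {T : Type} (a b : T -> R) : mp_convex (mp_segment a b).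
Proof.
  intros x y [u|] [v|] [p [q [Hpq ->]]] [p' [q' [Hpq' ->]]] H; simpl in H;
    try discriminate; injection H as H; unfold mp_comb.
  - exists (Rmax (u + p) (v + p')), (Rmax (u + q) (v + q')). split; [minmax|].
    apply functional_extensionality. intros t. clear - t. minmax.
  - exists p, q. split; [auto|]. apply functional_extensionality. intros t. subst; lra.
  - exists p', q'. split; [auto|]. apply functional_extensionality. intros t. subst; lra.
Qed.

Lemma mp_path_open {T : Type} (U : (T -> R) -> Prop) (a b : T -> R) (s : R) :
  prod_top T U -> U (mp_path a b s) -> exists (F : list T) (eps : R), 0 < eps /\
    forall a' b' s', (forall t, In t F -> Rabs (a' t - a t) < eps) ->
      (forall t, In t F -> Rabs (b' t - b t) < eps) -> Rabs (s' - s) < eps ->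
      U (mp_path a' b' s').
Proof.
  intros HU Us. destruct (prod_top_nbhd U _ HU Us) as [F [eps [Heps HF]]].
  exists F, (eps / 2). split; [lra|]. intros a' b' s' Ha Hb Hs.
  apply HF. intros t Ht. replace eps with (2 * (eps / 2)) by lra.
  apply mp_path_lipschitz; auto.
Qed.

Lemma mp_segment_compact {T : Type} (a b : T -> R) :
  (forall t, 0 <= a t <= 1) -> (forall t, 0 <= b t <= 1) ->
  Defs.compact (prod_top T) (mp_segment a b).
Proof.
  intros Ha Hb C HC Hcov.
  assert (exists l, Forall C l /\ forall s, -1 <= s <= 1 ->
    exists U, In U l /\ U (mp_path a b s)) as [l [Hl Hlc]].
  { apply (interval_chain (fun u v => exists l, Forall C l /\ forall s, u <= s <= v ->
      exists U, In U l /\ U (mp_path a b s))); [lra| |].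
    - intros u v w [l [Hl Hlc]] [m [Hm Hmc]]. exists (l ++ m).
      split; [apply Forall_app; auto|]. intros s Hs.
      destruct (Rle_dec s v) as [H|H].
      + destruct (Hlc s) as [U [HU Us]]; [lra|]. exists U. rewrite in_app_iff. auto.
      + destruct (Hmc s) as [U [HU Us]]; [lra|]. exists U. rewrite in_app_iff. auto.
    - intros s Hs. destruct (Hcov (mp_path a b s)) as [U [CU Us]].
      { apply mp_segment_path; eauto. }
      destruct (mp_path_open U a b s (HC U CU) Us) as [F [eps [Heps HF]]].
      exists eps. split; [auto|]. intros u v Hu Huv Hv. exists [U].
      split; [auto|]. intros s' Hs'. exists U. split; [left; auto|].
      apply HF; [intros t _|intros t _|]; apply Rabs_def1; lra. }
  exists l. split; [auto|]. intros x Hx. apply mp_segment_path in Hx; auto.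
  destruct Hx as [s [Hs ->]]. auto.
Qed.

Definition clamp (r : R) := Rmax 0 (Rmin 1 r).

Lemma clamp_range (r : R) : 0 <= clamp r <= 1.
Proof. unfold clamp. minmax. Qed.

Lemma clamp_id (r : R) : 0 <= r <= 1 -> clamp r = r.
Proof. unfold clamp. intros. minmax. Qed.

Lemma clamp_lipschitz (r s eps : R) : Rabs (r - s) < eps -> Rabs (clamp r - clamp s) < eps.
Proof. intros H. apply Rabs_def2 in H. apply Rabs_def1; unfold clamp; minmax. Qed.

(** Truncation makes every point of the power indexed by [T * bool] code a pair of points of the
    cube, so that lemmas about full powers of the line apply. *)
Definition start {T : Type} (v : T * bool -> R) (t : T) := clamp (v (t, true)).
Definition finish {T : Type} (v : T * bool -> R) (t : T) := clamp (v (t, false)).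

Lemma segment_mpcc_pred {T : Type} (v : T * bool -> R) :
  mpcc_pred T (mp_segment (start v) (finish v)).
Proof.
  split; [|split].
  - exists (mp_path (start v) (finish v) 0). apply mp_segment_path;
      [intros; apply clamp_range|intros; apply clamp_range|].
    exists 0. split; [lra|reflexivity].
  - apply mp_segment_compact; intros; apply clamp_range.
  - apply mp_segment_convex.
Qed.

Definition segment {T : Type} (v : T * bool -> R) : mpcc T :=
  exist _ _ (segment_mpcc_pred v).

Lemma segment_path {T : Type} (v : T * bool -> R) (x : T -> R) :
  proj1_sig (segment v) x <-> exists s, -1 <= s <= 1 /\ x = mp_path (start v) (finish v) s.
Proof. apply mp_segment_path; intros; apply clamp_range. Qed.

Lemma segment_swap {T : Type} (v v' : T * bool -> R) :
  (forall t, v' (t, true) = v (t, false) /\ v' (t, false) = v (t, true)) ->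
  segment v' = segment v.
Proof.
  intros H. unfold segment.
  assert (E : mp_segment (start v') (finish v') = mp_segment (start v) (finish v)).
  { rewrite mp_segment_comm. f_equal; apply functional_extensionality; intros t;
      unfold start, finish; destruct (H t) as [E1 E2]; congruence. }
  generalize (segment_mpcc_pred v) (segment_mpcc_pred v').
  rewrite E. intros. f_equal. apply proof_irrelevance.
Qed.

Lemma segment_path_nbhd {T : Type} (U : (T -> R) -> Prop) (v : T * bool -> R) (s : R) :
  prod_top T U -> U (mp_path (start v) (finish v) s) ->
  exists (F : list (T * bool)) (eps : R), 0 < eps /\
    forall v' s', (forall i, In i F -> Rabs (v' i - v i) < eps) -> Rabs (s' - s) < eps ->
      U (mp_path (start v') (finish v') s').
Proof.
  intros HU Us. destruct (mp_path_open U _ _ s HU Us) as [F [eps [Heps HF]]].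
  exists (list_prod F [true; false]), eps. split; [auto|].
  intros v' s' Hv Hs. apply HF; auto; intros t Ht; apply clamp_lipschitz, Hv, in_prod;
    simpl; auto.
Qed.

(** For segments contained in [U], [interval_chain] finds one neighbourhood of [v] valid for all
    parameters; for segments meeting [U], a single parameter is followed. *)
Lemma segment_continuous (T : Type) :
  continuous (prod_top (T * bool)) (vietoris T) segment.
Proof.
  apply continuous_generated. intros V [U [HU [HV|HV]]]; apply prod_top_intro; intros v Vv;
    rewrite HV in Vv.
  - destruct (interval_chain (fun u w => exists (F : list (T * bool)) (eps : R), 0 < eps /\
      forall v', (forall i, In i F -> Rabs (v' i - v i) < eps) -> forall s, u <= s <= w ->
        U (mp_path (start v') (finish v') s)) (-1) 1) as [F [eps [Heps HF]]].
    + lra.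
    + intros u w z [F [eps [Heps HF]]] [G [del [Hdel HG]]].
      exists (F ++ G), (Rmin eps del). split; [apply Rmin_pos; auto|].
      intros v' Hv s Hs. destruct (Rle_dec s w) as [H|H]; [apply HF|apply HG]; try lra;
        intros i Hi; (eapply Rlt_le_trans; [apply Hv, in_app_iff; auto|]);
        [apply Rmin_l|apply Rmin_r].
    + intros s Hs. destruct (segment_path_nbhd U v s HU) as [F [eps [Heps HF]]].
      { apply Vv. apply segment_path. eauto. }
      exists eps. split; [auto|]. intros u w Hu Huw Hw. exists F, eps. split; [auto|].
      intros v' Hv s' Hs'. apply HF; [auto|]. apply Rabs_def1; lra.
    + exists F, eps. split; [auto|]. intros v' Hv. apply HV. intros x Hx.
      apply segment_path in Hx. destruct Hx as [s [Hs ->]]. auto.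
  - destruct Vv as [x [Hx Ux]]. apply segment_path in Hx. destruct Hx as [s [Hs ->]].
    destruct (segment_path_nbhd U v s HU Ux) as [F [eps [Heps HF]]].
    exists F, eps. split; [auto|]. intros v' Hv. apply HV.
    exists (mp_path (start v') (finish v') s). split.
    + apply segment_path. eauto.
    + apply HF; [auto|]. replace (s - s) with 0 by lra. rewrite Rabs_R0. auto.
Qed.

(** * The contradiction *)

(** Since [W] is itself open, relatively open preimages are open in the whole power, where
    [disjoint_opens_separated] applies. *)
Lemma functionally_open_preimage {K Z : Type} (OZ : opens Z) (W : (K -> R) -> Prop)
    (g : {w | W w} -> Z) (N : Z -> Prop) :
  functionally_open (prod_top K) W -> continuous (subspace (prod_top K) W) OZ g -> OZ N ->
  prod_top K (fun w => exists Hw : W w, N (g (exist _ w Hw))).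
Proof.
  intros [f [Hf [_ HW]]] Hg HN. destruct (Hg N HN) as [O [HO HgO]].
  apply generated_local. intros w [Hw Nw].
  exists (fun w => 0 < f w /\ O w). split; [|split].
  - apply generated_and; [|auto]. apply (Hf (fun r => 0 < r)), R_open_gt.
  - split; [apply HW, Hw|]. apply HgO in Nw. auto.
  - intros w' [Hw' Ow']. apply HW in Hw'. exists Hw'. apply HgO. auto.
Qed.

(** This and [lies_above] are disjoint Vietoris open conditions on the trace in the coordinates [t],
    [c]; rational bounds make countably many such pairs. *)
Definition meets_below {T : Type} (t c : T) (p q : R) (L : mpcc T) :=
  exists x, proj1_sig L x /\ (x t < p /\ x c < q).

Definition lies_above {T : Type} (t c : T) (p q : R) (L : mpcc T) :=
  forall x, proj1_sig L x -> (p < x t \/ q < x c).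

Lemma meets_below_open {T : Type} (t c : T) (p q : R) :
  vietoris T (meets_below t c p q).
Proof.
  apply generated_subbasic. exists (fun x => x t < p /\ x c < q).
  split; [|right; unfold meets_below; tauto].
  apply generated_and; [apply (prod_top_coord t (fun r => r < p))|
    apply (prod_top_coord c (fun r => r < q))]; apply R_open_lt.
Qed.

Lemma lies_above_open {T : Type} (t c : T) (p q : R) :
  vietoris T (lies_above t c p q).
Proof.
  apply generated_subbasic. exists (fun x => p < x t \/ q < x c).
  split; [|left; unfold lies_above; tauto].
  apply generated_local. intros x [Hx|Hx].
  - exists (fun x => p < x t). split; [|auto].
    apply (prod_top_coord t (fun r => p < r)), R_open_gt.
  - exists (fun x => q < x c). split; [|auto].
    apply (prod_top_coord c (fun r => q < r)), R_open_gt.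
Qed.

Definition close_coords {T : Type} (a b : T) (L : mpcc T) :=
  forall x, proj1_sig L x -> Rabs (x a - x b) < 1 / 3.

Lemma close_coords_open {T : Type} (a b : T) : vietoris T (close_coords a b).
Proof.
  apply generated_subbasic. exists (fun x => Rabs (x a - x b) < 1 / 3).
  split; [|left; unfold close_coords; tauto].
  apply prod_top_intro. intros x Hx.
  exists [a; b], ((1 / 3 - Rabs (x a - x b)) / 2). split; [lra|].
  intros y Hy.
  assert (Ha := Hy a (or_introl eq_refl)).
  assert (Hb := Hy b (or_intror (or_introl eq_refl))).
  revert Ha Hb. clear. intros. minmax.
Qed.

Definition point {T : Type} (a b c : T) (x y z : R) (t : T) : R :=
  if excluded_middle_informative (t = a) then x else
  if excluded_middle_informative (t = b) then y else
  if excluded_middle_informative (t = c) then z else 0.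

Definition endpoints {T : Type} (u v : T -> R) (i : T * bool) : R :=
  if snd i then u (fst i) else v (fst i).

Lemma start_endpoints {T : Type} (u v : T -> R) (t : T) :
  0 <= u t <= 1 -> start (endpoints u v) t = u t.
Proof. apply clamp_id. Qed.

Lemma finish_endpoints {T : Type} (u v : T -> R) (t : T) :
  0 <= v t <= 1 -> finish (endpoints u v) t = v t.
Proof. apply clamp_id. Qed.

Theorem theorem4p6 (tau : Type) (Htau : ~ card_le_omega1 tau) :
  ~ absolute_retract (vietoris tau).
Proof.
  intros [K [W [Y [HW [[HYW [r [Hr Hrfix]]] [h [hinv [Hhh [_ [Hh Hhinv]]]]]]]]]].
  pose (theta := fun v : tau * bool -> R => proj1_sig (h (segment v))).
  assert (Htheta : continuous (prod_top (tau * bool)) (prod_top K) theta).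
  { intros V HV. apply (segment_continuous tau (fun L => V (proj1_sig (h L)))).
    apply (Hh (fun z => V (proj1_sig z))). exists V. split; [auto|tauto]. }
  pose (g := fun w : {w | W w} => hinv (r w)).
  assert (Hg : continuous (subspace (prod_top K) W) (vietoris tau) g).
  { intros V HV. apply (Hr (fun y => V (hinv y))), Hhinv, HV. }
  pose (pre := fun (N : mpcc tau -> Prop) w => exists Hw : W w, N (g (exist _ w Hw))).
  assert (Hpre : forall N, vietoris tau N -> prod_top K (pre N)).
  { intros N HN. apply (functionally_open_preimage (vietoris tau)); auto. }
  (* [theta v] lies in [Y], which the retraction fixes, so [g] sends it back to [segment v]. *)
  assert (Hpre_theta : forall N v, N (segment v) -> pre N (theta v)).
  { intros N v HN. exists (HYW _ (proj2_sig (h (segment v)))). unfold g.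
    replace (r _) with (h (segment v)); [rewrite Hhh; auto|].
    apply eq_sig_hprop; [intros; apply proof_irrelevance|]. symmetry. apply Hrfix.
    apply (proj2_sig (h (segment v))). }
  (* A free pair for the empty relation shows that [tau] is inhabited. *)
  assert (exists c : tau, True) as [c _].
  { destruct (free_pair (fun _ _ : tau => False) Htau) as [c _]; [|eauto].
    intros _. exists (fun _ => []). tauto. }
  assert (HA : forall t, exists A : K -> Prop, enumerable A /\ forall m n w w',
      pre (meets_below t c (rational m) (rational n)) w ->
      pre (lies_above t c (rational m) (rational n)) w' ->
      (forall k, A k -> w k = w' k) -> False).
  { intros t.
    destruct (disjoint_open_families_separated
      (fun n => let (i, j) := Cantor.of_nat n in pre (meets_below t c (rational i) (rational j)))
      (fun n => let (i, j) := Cantor.of_nat n in pre (lies_above t c (rational i) (rational j))))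
      as [A [EA HA]].
    - intros n. destruct (Cantor.of_nat n). apply Hpre, meets_below_open.
    - intros n. destruct (Cantor.of_nat n). apply Hpre, lies_above_open.
    - intros n w. destruct (Cantor.of_nat n). intros [Hw [x [Hx Hlt]]] [Hw' Hab].
      rewrite (proof_irrelevance _ Hw' Hw) in Hab. specialize (Hab x Hx). lra.
    - exists A. split; [auto|]. intros m n w w'. specialize (HA (Cantor.to_nat (m, n)) w w').
      rewrite Cantor.cancel_of_to in HA. auto. }
  apply choice in HA. destruct HA as [A HA].
  destruct (choice (fun k D => enumerable D /\ forall x y,
      (forall i : tau * bool, D i -> x i = y i) -> theta x k = theta y k)) as [D HD].
  { intros k. apply continuous_coord_countable, Htheta. }
  (* Adding [t] and [c] to the countable set attached to [t] makes [a], [b], [c] distinct. *)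
  destruct (free_pair (fun t s =>
    (exists i, (exists k, A t k /\ D k i) /\ s = fst i) \/ (s = t \/ s = c)) Htau)
    as [a [b [Hab Hba]]].
  { intros t. apply enumerable_or; [|apply enumerable_or; apply enumerable_eq].
    apply enumerable_union; [|intros; apply enumerable_eq].
    apply enumerable_union; [apply HA|intros; apply HD]. }
  assert (Nab : a <> b) by (intros ->; tauto).
  assert (Nac : a <> c) by (intros ->; tauto).
  assert (Nbc : b <> c) by (intros ->; tauto).
  assert (HAa : forall k x y, A a k -> (forall i, fst i <> b -> x i = y i) ->
    theta x k = theta y k).
  { intros k x y Ak Hxy. apply HD. intros i Di. apply Hxy. intros <-. apply Hab. eauto 6. }
  assert (HAb : forall k x y, A b k -> (forall i, fst i <> a -> x i = y i) ->
    theta x k = theta y k).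
  { intros k x y Ak Hxy. apply HD. intros i Di. apply Hxy. intros <-. apply Hba. eauto 6. }
  clear Hab Hba.
  pose (v0 := endpoints (point a b c 0 0 0) (point a b c 1 1 0)).
  assert (Hv0 : close_coords a b (segment v0)).
  { intros x Hx. apply segment_path in Hx. destruct Hx as [s [_ ->]].
    replace (mp_path _ _ s a) with (mp_path (start v0) (finish v0) s b).
    - replace (_ - _) with 0 by lra. rewrite Rabs_R0. lra.
    - unfold mp_path, start, finish, v0, endpoints, point; simpl.
      repeat destruct excluded_middle_informative; try tauto; congruence. }
  destruct (prod_top_nbhd _ _ (Hpre _ (close_coords_open a b)) (Hpre_theta _ _ Hv0))
    as [F [eta [Heta HF]]].
  destruct (prod_top_nbhd _ v0 (Htheta _ (prod_top_ball F (theta v0) eta)))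
    as [G [del [Hdel HG]]].
  { intros k _. replace (_ - _) with 0 by lra. rewrite Rabs_R0. auto. }
  (* Below [del], a change by [eps] keeps [theta] within [eta] of [theta v0] on [F]; below 1, the
     endpoints stay in the cube. *)
  set (eps := Rmin 1 del / 2).
  assert (Heps : 0 < eps <= 1 / 2 /\ eps < del).
  { unfold eps. minmax. }
  clearbody eps.
  pose (v := endpoints (point a b c 0 1 0) (point a b c 1 0 eps)).
  (* Membership of [w] in [W] is not clear from the gluing; it comes with [Hw]. *)
  pose (w := fun k => if excluded_middle_informative (A a k \/ A b k)
    then theta v k else theta v0 k).
  assert (Hw : pre (close_coords a b) w).
  { apply HF. intros k Fk. unfold w.
    destruct excluded_middle_informative as [[Ak|Ak]|_].
    - rewrite (HAa k v (endpoints (point a b c 0 0 0) (point a b c 1 1 eps)) Ak).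
      + apply HG; [|auto]. intros [t e] _. unfold v0, endpoints, point; simpl.
        destruct e; repeat destruct excluded_middle_informative; apply Rabs_def1; lra.
      + intros [t e] Ht. unfold v, endpoints, point; simpl in *.
        destruct e; repeat destruct excluded_middle_informative; tauto.
    - assert (Ev : segment (endpoints (point a b c 1 0 eps) (point a b c 0 1 0)) = segment v).
      { apply segment_swap. intros t. split; reflexivity. }
      unfold theta at 1. rewrite <- Ev.
      change (Rabs (theta (endpoints (point a b c 1 0 eps) (point a b c 0 1 0)) k
        - theta v0 k) < eta).
      rewrite (HAb k _ (endpoints (point a b c 0 0 eps) (point a b c 1 1 0)) Ak).
      + apply HG; [|auto]. intros [t e] _. unfold v0, endpoints, point; simpl.
        destruct e; repeat destruct excluded_middle_informative; apply Rabs_def1; lra.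
      + intros [t e] Ht. unfold endpoints, point; simpl in *.
        destruct e; repeat destruct excluded_middle_informative; tauto.
    - replace (_ - _) with 0 by lra. rewrite Rabs_R0. auto. }
  assert (Ewa : forall k, A a k -> theta v k = w k).
  { intros k Ak. unfold w. destruct excluded_middle_informative; tauto. }
  assert (Ewb : forall k, A b k -> w k = theta v k).
  { intros k Ak. unfold w. destruct excluded_middle_informative; tauto. }
  assert (Hpoint : forall x y z t, 0 <= x <= 1 -> 0 <= y <= 1 -> 0 <= z <= 1 ->
    0 <= point a b c x y z t <= 1).
  { intros. unfold point. repeat destruct excluded_middle_informative; lra. }
  assert (Hpa : forall x y z, point a b c x y z a = x).
  { intros. unfold point. repeat destruct excluded_middle_informative; tauto. }
  assert (Hpb : forall x y z, point a b c x y z b = y).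
  { intros. unfold point. repeat destruct excluded_middle_informative; congruence. }
  assert (Hpc : forall x y z, point a b c x y z c = z).
  { intros. unfold point. repeat destruct excluded_middle_informative; congruence. }
  assert (Hstart : forall t, start v t = point a b c 0 1 0 t).
  { intros t. apply start_endpoints, Hpoint; lra. }
  assert (Hfinish : forall t, finish v t = point a b c 1 0 eps t).
  { intros t. apply finish_endpoints, Hpoint; lra. }
  (* From [x a <= p1 < 1/3] and closeness 1/3 follows [x b < 2/3 < p2]. The chain
     [0 < q2 < q1 < eps] absorbs the passage from strict to weak inequalities. *)
  destruct (rational_dense 0 (1 / 3)) as [p1 Hp1]; [lra|].
  destruct (rational_dense (2 / 3) 1) as [p2 Hp2]; [lra|].
  destruct (rational_dense 0 eps) as [q1 Hq1]; [lra|].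
  destruct (rational_dense 0 (rational q1)) as [q2 Hq2]; [lra|].
  destruct Hw as [Ww Hclose]. set (L := g (exist _ w Ww)) in Hclose.
  assert (exists x, proj1_sig L x /\ x a <= rational p1 /\ x c <= rational q2)
    as [x [Lx [Hxa Hxc]]].
  (* Otherwise [L] lies above the bounds, while the segment of [v] meets below them at its start,
     the parameter -1; yet [theta v] and [w] agree on [A a]. *)
  { apply NNPP. intros N. apply (proj2 (HA a) p1 q2 (theta v) w); [|exists Ww|exact Ewa].
    - apply Hpre_theta. exists (mp_path (start v) (finish v) (-1)). split.
      + apply segment_path. exists (-1). split; [lra|auto].
      + unfold mp_path. rewrite !Hstart, !Hfinish, !Hpa, !Hpc. split; minmax.
    - intros x Lx. fold L in Lx. apply NNPP. intros Hx. apply N. exists x. split; [auto|lra]. }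
  apply (proj2 (HA b) p2 q1 w (theta v)); [exists Ww| |exact Ewb].
  - exists x. fold L. split; [auto|]. specialize (Hclose x Lx).
    apply Rabs_def2 in Hclose. lra.
  - apply Hpre_theta. intros y Hy. apply segment_path in Hy. destruct Hy as [s [_ ->]].
    unfold mp_path. rewrite !Hstart, !Hfinish, !Hpb, !Hpc. revert Hp2 Hq1 Heps. clear.
    (* For [s <= 0] the start has coefficient 0 and the [b] coordinate is 1; for [s > 0] the finish
       has coefficient 0 and the [c] coordinate is [eps]. *)
    destruct (Rle_dec s 0); [left|right]; minmax.
Qed.
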